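(* Let $0<\alpha\le\infty$. If $f\in S_{\mathrm{pos}}^{(3)}(-\alpha,\alpha)$, then $f$ is continuous on $(-\alpha,\alpha)$.
   Context: For a real function $f$ on $(-\alpha,\alpha)$ and a real matrix $A=[a_{ij}]$ with all entries in $(-\alpha,\alpha)$, $f[A]:=[f(a_{ij})]$. For real symmetric matrices, $A\ge0$ means positive semidefinite. $S_{\mathrm{pos}}^{(n)}(-\alpha,\alpha)$ is the set of real functions $f$ on $(-\alpha,\alpha)$ such that $f[A]\ge0$ for all $A\ge0$ in $M_n(\mathbb{R})$ with entries in $(-\alpha,\alpha)$. *)

(* Defs.v *)
From HB Require Import structures.
From mathcomp Require Import all_boot all_order all_algebra.
From mathcomp Require Import all_classical all_reals all_analysis.

Set Implicit Arguments.
Unset Strict Implicit.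
Unset Printing Implicit Defensive.

Import Order.TTheory GRing.Theory Num.Theory.
Import numFieldNormedType.Exports.

Local Open Scope classical_set_scope.
Local Open Scope ring_scope.

(* alpha is an extended real, so that alpha = +oo gives the whole line. *)
Definition sym_itv (R : realType) (alpha : \bar R) : set R :=
  [set x : R | (- alpha < x%:E)%E /\ (x%:E < alpha)%E].

Definition psd (R : realType) (n : nat) (A : 'M[R]_n) : Prop :=
  A^T = A /\ forall x : 'cV[R]_n, 0 <= (x^T *m A *m x) ord0 ord0.

(* A real function on (-alpha, alpha) is represented by a total function on R
   whose values outside the interval play no role: map_mx f A is only
   considered for matrices A with all entries in (-alpha, alpha). *)
Definition S_pos (R : realType) (n : nat) (alpha : \bar R) : set (R -> R) :=
  [set f : R -> R | forall A : 'M[R]_n,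
    (forall i j, sym_itv alpha (A i j)) -> psd A -> psd (map_mx f A)].

(* Main.v *)
Require Import Defs.
From HB Require Import structures.
From mathcomp Require Import all_boot all_order all_algebra.
From mathcomp Require Import all_classical all_reals all_analysis.
From mathcomp Require Import ring lra.

(** Let [U], [W] be vectors of squared length [a] with inner product [x], where
    [`|x| <= a], and put [V = U + t W].  The Gram matrix of [W, U, V] is
    polynomial in [t] ([psd_gram]), and its [(W, V)] entry is [z = x + t a], which runs
    through a neighbourhood of [x] as [t] runs through one of [0].  If [f]
    preserves positivity, the image matrix is again the Gram matrix of some
    vectors [W', U', V'], and Cauchy-Schwarz for [W'] and [U' - V'] gives
    [(f x - f z)^2 <= f a * (f a - 2 f (a + t x) + f (a + 2 t x + t^2 a))]
    ([S_pos_cauchy_schwarz]).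
    The second factor only involves values of [f] near [a], so a small
    oscillation of [f] near one suitable [a >= `|x|] forces [f z] to be close
    to [f x].

    Such an [a] always exists: the case [t = 0] of the same Gram matrix shows
    that [f x <= f a] whenever [`|x| <= a] ([S_pos_le]), so [f] is nondecreasing on the
    nonnegative half of the domain, and repeated bisection of an interval there
    yields subintervals on which the increment of [f] is as small as desired
    ([small_increment]).  The centre of such a subinterval is the required [a]. *)

Set Implicit Arguments.
Unset Strict Implicit.
Unset Printing Implicit Defensive.

Import Order.TTheory GRing.Theory Num.Theory.
Import numFieldNormedType.Exports.

Local Open Scope classical_set_scope.
Local Open Scope ring_scope.

Definition sym3 (R : realType) (a b c d e g : R) : 'M[R]_3 :=
  \matrix_(i, j) nth 0 (nth [::] [:: [:: a; b; c]; [:: b; d; e]; [:: c; e; g]] i) j.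

Lemma sym3_formE (R : realType) (a b c d e g : R) (w : 'cV[R]_3) :
  (w^T *m sym3 a b c d e g *m w) ord0 ord0 =
  let p := w 0 0 in let q := w 1 0 in let r := w 2%:R 0 in
  a * p ^+ 2 + b * (p * q) *+ 2 + c * (p * r) *+ 2
  + d * q ^+ 2 + e * (q * r) *+ 2 + g * r ^+ 2.
Proof.
rewrite /=; have -> : (2%:R : 'I_3) = lift ord0 (lift ord0 ord0) by apply/val_inj.
have -> : (1 : 'I_3) = lift ord0 ord0 by apply/val_inj.
rewrite !mxE !big_ord_recl big_ord0 !mxE !big_ord_recl !big_ord0 !mxE /=.
ring.
Qed.

Lemma psd_sym3 (R : realType) (a b c d e g : R) :
  psd (sym3 a b c d e g) <->
  forall p q r, 0 <= a * p ^+ 2 + b * (p * q) *+ 2 + c * (p * r) *+ 2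
                     + d * q ^+ 2 + e * (q * r) *+ 2 + g * r ^+ 2.
Proof.
split=> [[_ H] p q r|H].
  have := H (\col_i nth 0 [:: p; q; r] i).
  by rewrite sym3_formE !mxE.
split; last by move=> w; rewrite sym3_formE; exact: H.
apply/matrixP => i j; rewrite !mxE.
by case: i => [[|[|[|//]]] ?]; case: j => [[|[|[|//]]] ?].
Qed.

Lemma map_sym3 (R : realType) (f : R -> R) (a b c d e g : R) :
  map_mx f (sym3 a b c d e g) = sym3 (f a) (f b) (f c) (f d) (f e) (f g).
Proof.
apply/matrixP => i j; rewrite !mxE.
by case: i => [[|[|[|//]]] ?]; case: j => [[|[|[|//]]] ?].
Qed.

Lemma sym_itv_le (R : realType) (alpha : \bar R) (b y : R) :
  (b%:E < alpha)%E -> `|y| <= b -> sym_itv alpha y.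
Proof.
move=> ba; rewrite ler_norml => /andP[yb1 yb2]; split.
  by rewrite lteNl -EFinN (le_lt_trans _ ba)// lee_fin lerNl.
by rewrite (le_lt_trans _ ba)// lee_fin.
Qed.

Lemma sym_itv_lt (R : realType) (alpha : \bar R) (x : R) :
  sym_itv alpha x -> exists2 b : R, `|x| < b & (b%:E < alpha)%E.
Proof.
case: alpha => [s| |] [].
- rewrite -EFinN !lte_fin => xs1 xs2.
  have xs : `|x| < s by rewrite ltr_norml xs1.
  by exists ((`|x| + s) / 2); rewrite ?lte_fin; lra.
- by move=> _ _; exists (`|x| + 1); rewrite ?ltry// ltrDl.
- by move=> _; rewrite ltNge leNye.
Qed.

(** The matrix is the Gram matrix of [W, U, U + t W], where [W] and [U] have
    squared length [a] and inner product [x]; hence its quadratic form at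
    [(p, q, r)] is that of [[a, x], [x, a]] at [(p + t r, q + r)]. *)
Lemma psd_gram (R : realType) (a x t : R) : `|x| <= a ->
  psd (sym3 a x (x + t * a) a (a + t * x) (a + t * x *+ 2 + t ^+ 2 * a)).
Proof.
rewrite ler_norml => /andP[xa1 xa2]; apply/psd_sym3 => p q r.
(* [a P^2 + 2 x P Q + a Q^2] splits along the eigenvectors [(1, 1)], [(1, -1)] *)
have -> : a * p ^+ 2 + x * (p * q) *+ 2 + (x + t * a) * (p * r) *+ 2
    + a * q ^+ 2 + (a + t * x) * (q * r) *+ 2
    + (a + t * x *+ 2 + t ^+ 2 * a) * r ^+ 2
  = ((a + x) * (p + t * r + (q + r)) ^+ 2
     + (a - x) * (p + t * r - (q + r)) ^+ 2) / 2 by field.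
rewrite divr_ge0// addr_ge0// mulr_ge0 ?sqr_ge0//; lra.
Qed.

Lemma S_pos_gram (R : realType) (alpha : \bar R) (f : R -> R) (b a x t : R) :
  S_pos 3%N alpha f -> (b%:E < alpha)%E ->
  `|x| <= a -> a <= b -> `|x + t * a| <= b -> `|a + t * x| <= b ->
  `|a + t * x *+ 2 + t ^+ 2 * a| <= b ->
  forall p q r, 0 <= f a * p ^+ 2 + f x * (p * q) *+ 2
    + f (x + t * a) * (p * r) *+ 2 + f a * q ^+ 2
    + f (a + t * x) * (q * r) *+ 2 + f (a + t * x *+ 2 + t ^+ 2 * a) * r ^+ 2.
Proof.
move=> hf hb xa ab zb yb cb; apply/psd_sym3; rewrite -map_sym3.
apply: hf; last exact: psd_gram.
have xb : `|x| <= b by exact: le_trans ab.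
have a0 : 0 <= a by exact: le_trans xa.
have ab' : `|a| <= b by rewrite ger0_norm.
move=> i j; apply: (sym_itv_le hb); rewrite mxE.
by case: i => [[|[|[|//]]] ?]; case: j => [[|[|[|//]]] ?].
Qed.

(** These are values, at [(1, 0, 0)] and [(1, -1, 0)], of the form obtained
    for [t = 0]. *)
Lemma S_pos_le (R : realType) (alpha : \bar R) (f : R -> R) (x a : R) :
  S_pos 3%N alpha f -> (a%:E < alpha)%E -> `|x| <= a ->
  0 <= f a /\ f x <= f a.
Proof.
move=> hf ha xa.
have a0 : 0 <= a by exact: le_trans xa.
have := @S_pos_gram _ _ _ a a x 0 hf ha xa (lexx a).
rewrite expr2 !mul0r mul0rn !addr0 (ger0_norm a0) => /(_ xa (lexx _) (lexx _)) H.
have := H 1 0 0; have := H 1 (-1) 0; split; lra.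
Qed.

(** Cauchy-Schwarz for [W'] and [U' - V']: minimise the form at [(p, 1, -1)]
    over [p].  Using an upper bound [M > 0] of [f a] instead of [f a] itself
    covers the case [f a = 0] as well. *)
Lemma S_pos_cauchy_schwarz (R : realType) (alpha : \bar R) (f : R -> R)
    (b a x t M : R) :
  S_pos 3%N alpha f -> (b%:E < alpha)%E ->
  `|x| <= a -> a <= b -> `|x + t * a| <= b -> `|a + t * x| <= b ->
  `|a + t * x *+ 2 + t ^+ 2 * a| <= b -> 0 < M -> f a <= M ->
  (f x - f (x + t * a)) ^+ 2 <=
    M * (f a - f (a + t * x) *+ 2 + f (a + t * x *+ 2 + t ^+ 2 * a)).
Proof.
move=> hf hb xa ab zb yb cb M0 faM.
set d := f x - _; set D := f a - _ + _.
have := S_pos_gram hf hb xa ab zb yb cb (- (d / M)) 1 (-1).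
rewrite -/d => H.
have {}H : 0 <= M * (d / M) ^+ 2 - (d / M) * d *+ 2 + D.
  have : 0 <= (M - f a) * (d / M) ^+ 2 by rewrite mulr_ge0 ?sqr_ge0 ?subr_ge0.
  rewrite /D /d in H *; lra.
have E : M * (M * (d / M) ^+ 2 - (d / M) * d *+ 2 + D) = M * D - d ^+ 2.
  by field; rewrite gt_eqF.
by rewrite -subr_ge0 -E mulr_ge0// ltW.
Qed.

(** At each bisection, one of the two halves carries at most half of the
    increment. *)
Lemma small_increment (R : realType) (f : R -> R) (c b e : R) :
  c < b -> 0 < e ->
  exists u v, [/\ c <= u, u < v, v <= b & f v - f u < e].
Proof.
move=> cb e0.
have [n ne] : exists n : nat, (f b - f c) / 2 ^+ n < e.
  exists (Num.bound ((f b - f c) / e)).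
  rewrite ltr_pdivrMr ?exprn_gt0// mulrC -ltr_pdivrMr//.
  exact: upper_nthrootP.
suff [u [v [? ? ? uv]]] : exists u v,
    [/\ c <= u, u < v, v <= b & f v - f u <= (f b - f c) / 2 ^+ n].
  by exists u, v; split=> //; exact: le_lt_trans ne.
elim: n {ne} => [|n [u [v [cu uv vb H]]]].
  by exists c, b; rewrite expr0 divr1.
have E : (f b - f c) / 2 ^+ n = (f b - f c) / 2 ^+ n.+1 *+ 2.
  by rewrite exprS; field; rewrite expf_neq0.
rewrite E in H; pose m := (u + v) / 2.
have [Hm|Hm] := leP (f m - f u) ((f b - f c) / 2 ^+ n.+1).
  by exists u, m; rewrite /m in Hm *; split=> //; lra.
by exists m, v; rewrite /m in Hm *; split=> //; lra.
Qed.

Theorem proposition2p5 (R : realType) (alpha : \bar R) (halpha : (0 < alpha)%E)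
    (f : R -> R) (hf : S_pos 3%N alpha f) :
  {within sym_itv alpha, continuous f}.
Proof.
apply: continuous_in_subspaceT => x /set_mem /sym_itv_lt[b xb hb].
apply/cvgrPdist_lt => e e0.
have x0 := normr_ge0 x.
pose M := f b + 1.
have M0 : 0 < M.
  by rewrite /M; have [? _] := S_pos_le hf hb (ltW xb); lra.
have e'0 : 0 < e ^+ 2 / (2 * M) by rewrite divr_gt0 ?exprn_gt0// mulr_gt0.
have [u [v [xu uv vb fuv]]] := small_increment f xb e'0.
have hv : (v%:E < alpha)%E by rewrite (le_lt_trans _ hb)// lee_fin.
(* the increment of [f] over [[u, v]] bounds its oscillation there *)
have fle s : u <= s -> s <= v -> f u <= f s <= f v.
  move=> us sv.
  have hs : (s%:E < alpha)%E by rewrite (le_lt_trans _ hv)// lee_fin.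
  have [_ ->] : 0 <= f s /\ f u <= f s.
    by apply: (S_pos_le hf hs); rewrite ger0_norm//; lra.
  have [_ ->//] : 0 <= f v /\ f s <= f v.
  by apply: (S_pos_le hf hv); rewrite ger0_norm//; lra.
have fvM : f v <= M.
  have [_] : 0 <= f b /\ f v <= f b.
    by apply: (S_pos_le hf hb); rewrite ger0_norm//; lra.
  by rewrite /M; lra.
pose a := (u + v) / 2; pose h := (v - u) / 2.
have h0 : 0 < h by rewrite /h; lra.
have a0 : 0 < a by rewrite /a; lra.
have ah : h <= a by rewrite /h /a; lra.
have av : a + h = v by rewrite /h /a; field.
have au : a - h = u by rewrite /h /a; field.
(* With [`|t| <= 1] and [`|x| <= a], the entries [a + t x] and
   [a + 2 t x + t^2 a] are within [3 `|t a|] of [a]. *)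
have h3 : 0 < h / 3 by lra.
near=> z.
have zx : `|x - z| < h / 3 by near: z; exact: (@cvgr_dist_lt _ _ _ _ _ id).
pose t := (z - x) / a.
have zE : x + t * a = z by rewrite /t divfK ?gt_eqF// addrC subrK.
have ta : `|t| * a = `|x - z|.
  by rewrite -{1}(gtr0_norm a0) -normrM /t divfK ?gt_eqF// distrC.
have t1 : `|t| <= 1.
  by rewrite -(ler_pM2r a0) ta; lra.
have xa : `|x| <= a by rewrite /a; lra.
have tx : `|t * x| <= `|x - z| by rewrite normrM -ta ler_wpM2l.
have tta : `|t ^+ 2 * a| <= `|x - z|.
  rewrite normrM (gtr0_norm a0) -ta ler_wpM2r ?(ltW a0)// normrX.
  by rewrite expr2 ler_piMl.
move: tx tta; rewrite !ler_norml => /andP[tx1 tx2] /andP[tta1 tta2].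
have zv : `|x + t * a| <= v.
  rewrite zE; have := ler_distD x 0 z; rewrite !sub0r !normrN; lra.
have yv : `|a + t * x| <= v by rewrite ger0_norm; lra.
have cv : `|a + t * x *+ 2 + t ^+ 2 * a| <= v by rewrite ger0_norm; lra.
have Fa : f u <= f a <= f v by apply: fle; lra.
have Fy : f u <= f (a + t * x) <= f v by apply: fle; lra.
have Fc : f u <= f (a + t * x *+ 2 + t ^+ 2 * a) <= f v by apply: fle; lra.
have avle : a <= v by lra.
have faM : f a <= M by lra.
have := S_pos_cauchy_schwarz hf hv xa avle zv yv cv M0 faM.
rewrite zE => H.
rewrite -(ltr_pXn2r (n := 2))// ?nnegrE ?(ltW e0)// real_normK ?num_real//.
apply: (le_lt_trans H).
have -> : e ^+ 2 = M * (2 * (e ^+ 2 / (2 * M))) by field; rewrite gt_eqF.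
rewrite ltr_pM2l//; lra.
Unshelve. all: by end_near.
Qed.
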